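(* Let $q=p_1p_2\cdots p_r s_1 s_2\cdots s_m$ be a squarefree positive integer, where the $p_i$ are primes of the form $3k+2$, the $s_l$ are primes of the form $3k+1$, and, if $3\mid q$, the prime $3$ is listed among the $p_i$. Then there exists a cubic modular witness function modulo $q$, $$g^{(q)}(y)=b_0+\sum_{j=1}^{q-1} b_j\bigl(e(j^3y/q)+e(-j^3y/q)\bigr)\ge 0 \quad (y=0,1,\dots,q-1),\qquad g^{(q)}(0)=1,$$ with real coefficients $b_j$, such that $$b_0\le \Bigl(\prod_{i=1}^{r}\frac{1}{p_i}\Bigr)\Bigl(\prod_{l=1}^{m}\frac{2}{\sqrt{s_l}}\Bigr)\le \frac{2^m}{\sqrt{q}}.$$ Consequently $\lambda(C_0^{(q)})\le \frac{2^m}{\sqrt q}$, and for every $\varepsilon>0$ one has $\lambda(C_0^{(q)})=O_\varepsilon(q^{-1/2+\varepsilon})$ (over squarefree $q$).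
   Context: Notation: $e(x)=e^{2\pi i x}$. For a positive integer $q$, a cubic modular witness function modulo $q$ is a function of the form $g^{(q)}(y)=b_0+\sum_{1\le j\le q-1,\ q\nmid j^3} b_j\bigl(e(j^3y/q)+e(-j^3y/q)\bigr)$ with real coefficients $b_j$, satisfying $g^{(q)}(y)\ge 0$ for all $y=0,1,\dots,q-1$ and $g^{(q)}(0)=1$. Let $C^{(q)}$ be the set of nonzero cubic residues modulo $q$ (nonzero elements $x\in\mathbb{Z}_q$ with $x\equiv j^3 \pmod q$ for some integer $j$), and $C_0^{(q)}=C^{(q)}\cup\{0\}$. $\lambda(C_0^{(q)})$ denotes the minimal possible value of the constant term $b_0$ over all cubic modular witness functions modulo $q$. *)

(* Defs.v *)
From HB Require Import structures.
From mathcomp Require Import all_boot all_order all_algebra.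
From mathcomp Require Import complex.
From mathcomp Require Import all_classical all_reals all_analysis.

Set Implicit Arguments.
Unset Strict Implicit.
Unset Printing Implicit Defensive.

Import Order.TTheory GRing.Theory Num.Theory.

Local Open Scope classical_set_scope.
Local Open Scope ring_scope.

Definition squarefree (q : nat) : Prop :=
  (0 < q)%N /\ forall d : nat, (1 < d)%N -> ~~ (d ^ 2 %| q)%N.

Section CubicWitness.
Variable R : realType.

(* e(x) = exp(2 pi i x), through Euler's formula. *)
Definition e (x : R) : R[i] :=
  (cos (2 * pi * x) +i* sin (2 * pi * x))%C.

(* Only the values b j with j < q are used; b 0 is the constant term b_0. *)
Definition cubic_fun (q : nat) (b : nat -> R) (y : int) : R[i] :=
  (b 0%N)%:C%C
  + \sum_(1 <= j < q | ~~ (q %| j ^ 3)%N)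
      (b j)%:C%C * (e ((j ^ 3)%:R * y%:~R / q%:R)
                    + e (- ((j ^ 3)%:R * y%:~R / q%:R))).

(* In the order of R[i], 0 <= z means that z is real and nonnegative. *)
Definition cubic_modular_witness (q : nat) (b : nat -> R) : Prop :=
  (forall y : nat, (y < q)%N -> 0 <= cubic_fun q b y%:Z)
  /\ cubic_fun q b 0 = 1.

(* lambda(C_0^(q)); the infimum in R of the set of admissible constant
   terms. *)
Definition lambda_C0 (q : nat) : R :=
  inf [set b 0%N | b in cubic_modular_witness q].

End CubicWitness.

(* Main.v *)
(**
A function with nonnegative values on Z/q and Fourier support on the cubes is
the Fourier transform of a signed weight on cubes, whose mass at 0 is the mean
[b_0].  By the Chinese remainder theorem such weights multiply over coprime
moduli, so one prime at a time suffices.  If every residue mod p is a cube, the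
uniform weight gives the indicator of 0, with mean 1/p.  In general, let
[T a = sum_j e(a j^3 / p)]: it is real, vanishes in mean over [a <> 0], has
square sum at most [2 p (p - 1)] there, and is constant on cosets of the cubes,
whence [T a ^ 2 <= 4 p].  Adding the constant [c = 2 / sqrt p] to [T / p] and
normalising yields a nonnegative function with mean
[(1 / p + c) / (1 + c) <= c].

Averaging a witness over [y] shows [b_0 >= 0], so the infimum is a genuine one.
For the asymptotic bound, [2 <= p ^ eps] for all but boundedly many primes p.
*)
Require Import Defs.
From HB Require Import structures.
From mathcomp Require Import all_boot all_order all_algebra all_field.
From mathcomp Require Import complex.
From mathcomp Require Import all_classical all_reals all_analysis.
From mathcomp Require Import ring lra zify.

Import Order.TTheory GRing.Theory Num.Theory.

Local Open Scope classical_set_scope.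
Local Open Scope ring_scope.

(** * The exponential [e] and roots of unity *)

Section Exponential.
Variable R : realType.
Implicit Types (x y : R) (n q : nat).

Lemma eD x y : e (x + y) = e x * e y.
Proof.
rewrite /e mulrDr cosD sinD; apply/eqP; rewrite eq_complex /= eqxx /=.
by apply/eqP; rewrite addrC.
Qed.

Lemma e0 : e 0 = 1 :> R[i].
Proof. by rewrite /e mulr0 cos0 sin0. Qed.

Lemma eN x : e (- x) = ((e x)^*)%C.
Proof. by rewrite /e mulrN cosN sinN. Qed.

Lemma conjc_e x : ((e x)^*)%C = (e x)^-1.
Proof.
rewrite -eN; have : e x * e (- x) = 1 by rewrite -eD subrr e0.
move=> h; have ex0 : e x != 0.
  by apply/eqP => ex0; move: h; rewrite ex0 mul0r => /eqP; rewrite eq_sym oner_eq0.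
by apply: (mulfI ex0); rewrite h mulfV.
Qed.

Lemma e_natM n x : e (n%:R * x) = e x ^+ n.
Proof.
by elim: n => [|n IH]; rewrite ?mul0r ?e0 // -natr1 mulrDl mul1r eD IH exprSr.
Qed.

Lemma e_addN x : e x + e (- x) = (2 * complex.Re (e x))%:C%C.
Proof.
rewrite eN /e; apply/eqP; rewrite eq_complex /= subrr; move: (cos _) => u.
by rewrite mulr_natl mulr2n !eqxx.
Qed.

(** The real part is [1 - 2 * sin (pi * x) ^+ 2], and the sine is positive strictly between 0 and
    [pi]. *)
Lemma e_neq1 x : 0 < x < 1 -> e x != 1.
Proof.
move=> /andP[x0 x1]; rewrite eq_complex /= negb_and; apply/orP; left.
have -> : 2 * pi * x = (pi * x) *+ 2 by ring.
rewrite cos_mulr2n cos2sin2.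
have : 0 < sin (pi * x).
  by apply: sin_gt0_pi; rewrite mulr_gt0 ?pi_gt0 //= gtr_pMr ?pi_gt0.
move=> s0; have : 0 < sin (pi * x) ^+ 2 by rewrite exprn_gt0.
by move=> h; rewrite neq_lt; apply/orP; left; lra.
Qed.

Lemma eV_expq q : (0 < q)%N -> e (q%:R^-1 : R) ^+ q = 1.
Proof.
move=> q0; rewrite -e_natM mulfV ?pnatr_eq0 -?lt0n //.
by rewrite /e mulr1 mulr_natl cos2pi sin2pi.
Qed.

Lemma eV_expn_eq1 q n : (0 < q)%N -> (e (q%:R^-1 : R) ^+ n == 1) = (q %| n)%N.
Proof.
move=> q0; apply/idP/idP => [|/dvdnP[k ->]]; last first.
  by rewrite mulnC exprM eV_expq // expr1n.
apply: contraTT; rewrite /dvdn -lt0n => nq.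
rewrite -(@expr_mod _ q) ?eV_expq // -e_natM; apply: e_neq1.
by rewrite divr_gt0 ?ltr0n //= ltr_pdivrMr ?ltr0n // mul1r ltr_nat ltn_mod.
Qed.

Lemma eV_mull q n : (0 < n)%N -> e ((n * q)%:R^-1 : R) ^+ n = e (q%:R^-1).
Proof.
move=> n0; rewrite -e_natM natrM invfM mulrA mulfV ?mul1r //.
by rewrite pnatr_eq0 -lt0n.
Qed.

Lemma Re_sum (I : Type) (r : seq I) (P : pred I) (F : I -> R[i]) :
  complex.Re (\sum_(i <- r | P i) F i) = \sum_(i <- r | P i) complex.Re (F i).
Proof. exact: (raddf_sum (@complex.Re R : Rcomplex R -> R)). Qed.

Lemma Re_realM x (z : R[i]) : complex.Re (x%:C%C * z) = x * complex.Re z.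
Proof. by case: z => a b /=; rewrite mul0r subr0. Qed.

End Exponential.

(** * Cubic Gauss sums over ['F_p] *)

Section CubicGaussSum.
Variables (R : realType) (p : nat) (zeta : R[i]).
Hypotheses (p_pr : prime p) (zeta_p : zeta ^+ p = 1) (zeta_neq1 : zeta != 1).
Hypothesis zetaJ : (zeta^*)%C = zeta^-1.
Implicit Types (a b c t x y : 'F_p).

(** The exponent is the representative of [x] below [p]; additivity in [x] comes from
    [zeta ^+ p = 1]. *)
Definition addchar (x : 'F_p) : R[i] := zeta ^+ x.

Lemma addchar_nat n : addchar n%:R = zeta ^+ n.
Proof. by rewrite /addchar val_Fp_nat // expr_mod. Qed.

Lemma addchar0 : addchar 0 = 1.
Proof. by rewrite (addchar_nat 0). Qed.

Lemma addcharD x y : addchar (x + y) = addchar x * addchar y.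
Proof.
by rewrite -[in LHS](natr_Zp x) -[in LHS](natr_Zp y) -natrD addchar_nat exprD.
Qed.

Lemma addcharN x : addchar (- x) = ((addchar x)^*)%C.
Proof.
have z0 : zeta != 0.
  apply/eqP => z0; move: zeta_p; rewrite z0 expr0n.
  by case: p p_pr => // k _ /eqP; rewrite eq_sym oner_eq0.
have x0 : addchar x != 0 by rewrite expf_neq0.
apply: (mulfI x0); rewrite -addcharD subrr addchar0.
by rewrite /addchar rmorphXn /= zetaJ exprVn mulfV ?expf_neq0.
Qed.

Lemma sum_addchar_mul x : \sum_b addchar (b * x) = if x == 0 then p%:R else 0.
Proof.
case: eqVneq => [->|x0].
  under eq_bigr do rewrite mulr0 addchar0.
  by rewrite sumr_const card_Fp.
rewrite -(reindex_inj (mulIf x0) (P := xpredT)) /=.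
set S := \sum_i _.
(* Translating the summation variable by 1 multiplies the sum by [zeta], which differs from 1, so
   the sum vanishes. *)
have S1 : S = zeta * S.
  rewrite mulr_sumr [LHS](reindex_inj (addrI 1)) /=; apply: eq_bigr => i _.
  by rewrite addcharD -[in addchar 1](mulr1n 1) addchar_nat expr1.
have : (zeta - 1) * S = 0 by rewrite mulrBl mul1r -S1 subrr.
by move/eqP; rewrite mulf_eq0 subr_eq0 (negPf zeta_neq1) => /eqP.
Qed.

Definition cubic_gauss a : R[i] := \sum_j addchar (a * j ^+ 3).

Lemma cubic_gauss0 : cubic_gauss 0 = p%:R.
Proof.
rewrite /cubic_gauss; under eq_bigr do rewrite mul0r addchar0.
by rewrite sumr_const card_Fp.
Qed.

(** Cubing is odd, so the substitution of [- j] for [j] turns the sum into its conjugate. *)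
Lemma cubic_gauss_real a : cubic_gauss a = (complex.Re (cubic_gauss a))%:C%C.
Proof.
have : ((cubic_gauss a)^*)%C = cubic_gauss a.
  rewrite /cubic_gauss rmorph_sum [RHS](reindex_inj oppr_inj) /=.
  by apply: eq_bigr => j _; rewrite -addcharN exprNn -signr_odd /= expr1 mulN1r mulrN.
case: (cubic_gauss a) => u v /= [] /eqP; rewrite -subr_eq0 -opprD oppr_eq0.
by rewrite -mulr2n mulrn_eq0 /= => /eqP ->.
Qed.

Lemma cubic_gauss_cube a t : t != 0 -> cubic_gauss (a * t ^+ 3) = cubic_gauss a.
Proof.
move=> t0; rewrite /cubic_gauss [RHS](reindex_inj (mulfI t0)) /=.
by apply: eq_bigr => j _; rewrite exprMn -mulrA.
Qed.

Lemma card_cube_roots c : (#|[pred j : 'F_p | j ^+ 3 == c]| <= 3)%N.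
Proof.
have P0 : size ('X^3 - c%:P : {poly 'F_p}) = 4%N by rewrite size_XnsubC.
rewrite cardE -ltnS -P0; apply: max_poly_roots.
- by rewrite -size_poly_eq0 P0.
- apply/allP => j; rewrite mem_enum inE => /eqP jc.
  by rewrite /root !hornerE jc subrr.
- exact: enum_uniq.
Qed.

Lemma card_cube_roots0 : #|[pred j : 'F_p | j ^+ 3 == 0]| = 1%N.
Proof. by rewrite -(card1 (0 : 'F_p)); apply: eq_card => j; rewrite !inE expf_eq0. Qed.

(** By orthogonality only the [j] with [j ^+ 3 = 0] survive the sum over [b]. *)
Lemma sum_cubic_gauss : \sum_b cubic_gauss b = p%:R.
Proof.
rewrite exchange_big /=.
under eq_bigr do rewrite sum_addchar_mul.
rewrite -big_mkcond sumr_const /=.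
by rewrite card_cube_roots0.
Qed.

(** Expanding the square and summing over [b] first, orthogonality counts the pairs with
    [k ^+ 3 + j ^+ 3 = 0]. *)
Lemma sum_sqr_cubic_gauss :
  \sum_b cubic_gauss b ^+ 2
  = (p * \sum_k #|[pred j : 'F_p | j ^+ 3 == - k ^+ 3]|)%:R.
Proof.
transitivity (\sum_b \sum_k \sum_j addchar (b * (k ^+ 3 + j ^+ 3))).
  apply: eq_bigr => b _; rewrite expr2 mulr_suml; apply: eq_bigr => k _.
  by rewrite mulr_sumr; apply: eq_bigr => j _; rewrite mulrDr addcharD.
rewrite exchange_big natrM natr_sum mulr_sumr /=; apply: eq_bigr => k _.
rewrite exchange_big /=.
under eq_bigr do rewrite sum_addchar_mul.
rewrite -big_mkcond sumr_const -[LHS]mulr_natr.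
congr (_ * _%:R); apply: eq_card => j.
by rewrite -[LHS]/(k ^+ 3 + j ^+ 3 == 0) !inE addrC addr_eq0.
Qed.

Lemma sum_card_cube_rootsN :
  (\sum_k #|[pred j : 'F_p | (j ^+ 3 == - k ^+ 3)%R]| <= 1 + 3 * p.-1)%N.
Proof.
rewrite (bigD1 (0%R : 'F_p)) //= leq_add //.
  by rewrite -[X in (_ <= X)%N]card_cube_roots0 expr0n oppr0.
apply: leq_trans (_ : (\sum_(k : 'F_p | k != 0%R) 3 <= _)%N).
  by apply: leq_sum => k _; apply: card_cube_roots.
rewrite sum_nat_const mulnC leq_mul2l /=.
have := cardC1 (0%R : 'F_p); rewrite card_Fp // => <-.
by rewrite leq_eqVlt; apply/orP; left; apply/eqP/eq_card => k; rewrite !inE.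
Qed.

Let T a : R := complex.Re (cubic_gauss a).

Let sumT : \sum_(b | b != 0) T b = 0.
Proof.
have := sum_cubic_gauss; rewrite (bigD1 0) //= cubic_gauss0.
move/(canRL (addKr _)); rewrite addNr => h.
by rewrite -Re_sum h.
Qed.

Let sumT2 : \sum_(b | b != 0) T b ^+ 2 <= 2 * p%:R * (p.-1)%:R.
Proof.
have p0 := prime_gt0 p_pr.
have : \sum_b T b ^+ 2 <= p%:R * (1 + 3 * (p.-1)%:R).
  have -> : \sum_b T b ^+ 2
          = (p * \sum_k #|[pred j : 'F_p | j ^+ 3 == - k ^+ 3]|)%:R.
    have := congr1 (@complex.Re R) sum_sqr_cubic_gauss.
    rewrite Re_sum -(rmorph_nat (real_complex R)) /= => <-.
    apply: eq_bigr => b _; rewrite [in RHS](cubic_gauss_real b).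
    by rewrite -rmorphXn.
  rewrite -[1]/(1%:R) -!natrM -natrD -natrM ler_nat leq_mul2l.
  by rewrite sum_card_cube_rootsN orbT.
(* The term at 0 is [p ^ 2], and [p * (1 + 3 * (p - 1)) - p ^ 2 = 2 * p * (p - 1)]. *)
rewrite (bigD1 0) //= /T cubic_gauss0 -(rmorph_nat (real_complex R)) /=.
have : p%:R = 1 + (p.-1)%:R :> R by rewrite -[in LHS](prednK p0) -nat1r.
by move=> ->; nra.
Qed.

(* The translate by [T a / 2] is optimal: [T] has mean zero, is constant on the
   coset of cubes through [a], and that coset has at least [(p - 1) / 3]
   elements. *)
Lemma cubic_gauss_bound a : a != 0 -> T a ^+ 2 <= 4 * p%:R.
Proof.
move=> a0; pose F b := (T b + T a / 2) ^+ 2.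
have p1 : 0 < (p.-1)%:R :> R by rewrite ltr0n -subn1 subn_gt0 prime_gt1.
have cardF : #|[pred b : 'F_p | b != 0]| = p.-1.
  by have := cardC1 (0 : 'F_p); rewrite card_Fp.
(* Each nonzero [b] equals [a * t ^+ 3] for at most three [t], and [F] is nonnegative. *)
have Fle : \sum_(t | t != 0) F (a * t ^+ 3) <= 3 * \sum_(b | b != 0) F b.
  rewrite (partition_big (fun t => a * t ^+ 3) (fun b => b != 0)) /=; last first.
    by move=> t t0; rewrite mulf_neq0 ?expf_neq0.
  rewrite mulr_sumr; apply: ler_sum => b b0.
  rewrite (eq_bigr (fun=> F b)); last by move=> t /andP[_ /eqP ->].
  rewrite sumr_const -[leLHS]mulr_natl ler_wpM2r ?sqr_ge0 // ler_nat.
  apply: leq_trans (card_cube_roots (a^-1 * b)); apply: subset_leq_card.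
  by apply/fintype.subsetP => t; rewrite !inE => /andP[_ /eqP <-]; rewrite mulKf.
have FaE : \sum_(t | t != 0) F (a * t ^+ 3) = (p.-1)%:R * F a.
  rewrite (eq_bigr (fun=> F a)); last first.
    by move=> t t0; rewrite /F /T cubic_gauss_cube.
  by rewrite sumr_const cardF mulr_natl.
have FE : \sum_(b | b != 0) F b
        = \sum_(b | b != 0) T b ^+ 2 + (p.-1)%:R * (T a / 2) ^+ 2.
  rewrite (eq_bigr (fun b => T b ^+ 2 + T a * T b + (T a / 2) ^+ 2)); last first.
    by move=> b _; rewrite /F; field.
  rewrite big_split big_split /= -mulr_sumr sumT mulr0 addr0.
  by rewrite sumr_const cardF mulr_natl.
rewrite FaE FE in Fle.
(* Since [F a] is [9/4 * T a ^+ 2], dividing by [p - 1] gives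
   [9/4 * T a ^+ 2 <= 6 * p + 3/4 * T a ^+ 2]. *)
rewrite -(ler_pM2l p1); move: Fle sumT2; rewrite /F; nra.
Qed.

End CubicGaussSum.

(** * Reindexing of sums and squarefree arithmetic *)

Lemma sum_Fp (V : nmodType) (p : nat) (f : nat -> V) :
  prime p -> \sum_(x : 'F_p) f x = \sum_(j < p) f j.
Proof. by move=> p_pr; rewrite -!(big_mkord xpredT f) Fp_cast. Qed.

Lemma sum_chinese (A : comNzRingType) (m n : nat) (F G : nat -> A) :
  (0 < m)%N -> (0 < n)%N -> coprime m n ->
  \sum_(j < m * n) F (j %% m)%N * G (j %% n)%N
  = (\sum_(i < m) F i) * (\sum_(k < n) G k).
Proof.
move=> m0 n0 cmn; rewrite big_distrlr pair_big /=.
pose h (j : 'I_(m * n)) := (Ordinal (ltn_pmod j m0), Ordinal (ltn_pmod j n0)).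
have h_inj : injective h.
  move=> i j [/eqP im /eqP jn]; apply: val_inj => /=.
  rewrite -(modn_small (ltn_ord i)) -(modn_small (ltn_ord j)); apply/eqP.
  by rewrite chinese_remainder // im jn.
rewrite (reindex h) //=; apply: onW_bij; apply: inj_card_bij => //.
by rewrite card_prod !card_ord.
Qed.

Lemma squarefree_dvd q d : squarefree q -> (d %| q)%N -> squarefree d.
Proof.
case=> q0 sq dq; split; first exact: dvdn_gt0 dq.
by move=> k k1; apply: contra (sq k k1) => /dvdn_trans; apply.
Qed.

Lemma squarefree_logn q p : squarefree q -> p \in primes q -> logn p q = 1%N.
Proof.
case=> q0 sq; rewrite mem_primes => /and3P[p_pr _ pq]; apply/eqP.
rewrite eqn_leq -(pfactor_dvdn 1) // expn1 pq andbT leqNgt.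
by rewrite -(pfactor_dvdn 2) // sq // prime_gt1.
Qed.

Lemma squarefree_prod_primes q : squarefree q -> (\prod_(p <- primes q) p)%N = q.
Proof.
move=> sq; have q0 := proj1 sq.
rewrite [RHS]prod_prime_decomp // prime_decompE big_map.
by apply: eq_big_seq => p pq /=; rewrite (squarefree_logn _ _ sq).
Qed.

(** Hence, for squarefree [q], the side condition in [cubic_fun] discards no index between 1 and
    [q - 1]. *)
Lemma squarefree_dvd_cube q j : squarefree q -> (q %| j ^ 3)%N = (q %| j)%N.
Proof.
move=> sq; have q0 := proj1 sq; apply/idP/idP => [|qj]; last exact: dvdn_exp.
move=> qj; apply/dvdn_partP => // p pq; have p_pr : prime p.
  by move: pq; rewrite mem_primes => /and3P[].
rewrite p_part (squarefree_logn _ _ sq) // expn1.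
have : (p %| j ^ 3)%N by apply: dvdn_trans qj; move: pq; rewrite mem_primes => /and3P[].
by rewrite Euclid_dvdX // andbT.
Qed.

(** * Weights on cubes: passage to witnesses, products, and the case of a prime *)

Section Weights.
Variable R : realType.
Implicit Types (q : nat) (b w : nat -> R) (c : R).

Local Notation zeta q := (e (q%:R^-1 : R)).

(* [w] assigns the weight [w j] to the cube [j ^ 3] modulo [q], and
   [cube_transform q w] is the Fourier transform of this signed measure. *)
Definition cube_transform q w (y : nat) : R[i] :=
  \sum_(j < q) (w j)%:C%C * zeta q ^+ (j ^ 3 * y).

(** The total mass is the value of the transform at 0. Positivity is asked at every natural [y], so
    that rescaling [y] preserves it, and [0 <= w 0] lets upper bounds be multiplied. *)
Definition cube_weight q c : Prop :=
  exists w, [/\ forall y, 0 <= cube_transform q w y, \sum_(j < q) w j = 1,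
                0 <= w 0%N & w 0%N <= c].

Lemma cubic_fun_nat q b (y : nat) :
  cubic_fun q b y%:Z = (b 0%N + \sum_(1 <= j < q | ~~ (q %| j ^ 3)%N)
     2 * b j * complex.Re (zeta q ^+ (j ^ 3 * y)))%:C%C.
Proof.
rewrite /cubic_fun rmorphD rmorph_sum /=; congr (_ + _); apply: eq_bigr => j _.
have -> : (j ^ 3)%:R * (y%:Z)%:~R = (j ^ 3 * y)%:R :> R by rewrite natrM pmulrn.
by rewrite e_addN e_natM -rmorphM /= mulrCA mulrA.
Qed.

Lemma cube_weight_witness q c : squarefree q -> cube_weight q c ->
  exists b, cubic_modular_witness q b /\ b 0%N <= c.
Proof.
move=> sq [w [w_ge0 w1 w00 w0c]]; have q0 := proj1 sq.
(* In [cubic_fun] each [b j] multiplies a conjugate pair, that is twice a real part; hence the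
   half. *)
pose b j := if j == 0%N then w 0%N else w j / 2.
have bE y : cubic_fun q b y%:Z = (complex.Re (cube_transform q w y))%:C%C.
  rewrite cubic_fun_nat /cube_transform Re_sum; congr (_%:C)%C.
  rewrite -(big_mkord xpredT (fun j => complex.Re ((w j)%:C%C * zeta q ^+ (j ^ 3 * y)))).
  rewrite [RHS]big_ltn // mul0n expr0 mulr1; congr (_ + _).
  rewrite big_mkcond /=; apply: eq_big_nat => j /andP[j0 jq].
  rewrite squarefree_dvd_cube // gtnNdvd //= Re_realM /b gtn_eqF //.
  by rewrite mulrCA mulfV ?mulr1 // pnatr_eq0.
exists b; split => //; split => [y yq|].
  have := w_ge0 y; rewrite bE !lecE /= eqxx /= => /andP[_]; exact.
rewrite (bE 0%N) /cube_transform Re_sum.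
under eq_bigr do rewrite muln0 expr0 mulr1 /=.
by rewrite w1.
Qed.

Lemma cube_weight1 : cube_weight 1 1.
Proof.
exists (fun=> 1); split => //; last by rewrite big_ord1.
by move=> y; rewrite /cube_transform big_ord1 mul0n expr0 mulr1 ler01.
Qed.

(** Modulo 1, the fraction [1 / (m * n)] is the sum of a multiple of [1 / m] and a multiple of
    [1 / n]; these multipliers are [u] and [v]. *)
Lemma cube_transform_coprime m n w1 w2 : (0 < m)%N -> (0 < n)%N -> coprime m n ->
  exists u v, forall y,
  cube_transform (m * n) (fun j => w1 (j %% m)%N * w2 (j %% n)%N) y
  = cube_transform m w1 (u * y) * cube_transform n w2 (v * y).
Proof.
move=> m0 n0 cmn.
(* These are the complementary idempotents modulo [m * n]: they add up to 1, [n] divides [a] and [m]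
   divides [b]. *)
pose a := chinese m n 1 0; pose b := chinese m n 0 1.
have na : (n %| a)%N by rewrite /dvdn chinese_modr // mod0n.
have mb : (m %| b)%N by rewrite /dvdn chinese_modl // mod0n.
have abE : (a + b = 1 %[mod m * n])%N.
  apply/eqP; rewrite chinese_remainder //; apply/andP; split.
    by rewrite -modnDm !chinese_modl // mod0n addn0 modn_mod.
  by rewrite -modnDm !chinese_modr // mod0n add0n modn_mod.
exists (a %/ n)%N, (b %/ m)%N => y.
have zE k : zeta (m * n) ^+ k = zeta m ^+ (a %/ n * k) * zeta n ^+ (b %/ m * k).
  rewrite -(eV_mull _ n m) // -(eV_mull _ m n) // (mulnC n m) -!exprM -exprD.
  rewrite !mulnA ![(_ * (_ %/ _))%N]mulnC !divnK // -mulnDl.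
  have mn0 : (0 < m * n)%N by rewrite muln_gt0 m0.
  rewrite -(expr_mod k (eV_expq _ _ mn0)) -[RHS](expr_mod _ (eV_expq _ _ mn0)).
  by rewrite -[in RHS]modnMml abE modnMml mul1n.
pose F l w t k j := (w j)%:C%C * zeta l ^+ (j ^ 3 * (t * k)).
rewrite -[RHS](sum_chinese _ m n (F m w1 (a %/ n)%N y) (F n w2 (b %/ m)%N y)) //.
have zmod l j t : (0 < l)%N -> zeta l ^+ ((j %% l) ^ 3 * t) = zeta l ^+ (j ^ 3 * t).
  move=> l0; rewrite -(expr_mod _ (eV_expq _ _ l0)) -[RHS](expr_mod _ (eV_expq _ _ l0)).
  by rewrite -modnMml modnXm modnMml.
apply: eq_bigr => j _; rewrite /F !zmod // zE rmorphM [RHS]mulrACA.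
by congr (_ * (_ * _)); rewrite mulnCA.
Qed.

Lemma cube_weight_coprime m n c d : (0 < m)%N -> (0 < n)%N -> coprime m n ->
  cube_weight m c -> cube_weight n d -> cube_weight (m * n) (c * d).
Proof.
move=> m0 n0 cmn [w1 [w1_ge0 w1_1 w100 w10c]] [w2 [w2_ge0 w2_1 w200 w20d]].
exists (fun j => w1 (j %% m)%N * w2 (j %% n)%N).
have [u [v uvE]] := cube_transform_coprime m n w1 w2 m0 n0 cmn.
split.
- by move=> y; rewrite uvE mulr_ge0.
- by rewrite sum_chinese // w1_1 w2_1 mulr1.
- by rewrite !mod0n mulr_ge0.
- by rewrite !mod0n ler_pM.
Qed.

Lemma sum_zeta_cube p (y : nat) : prime p ->
  \sum_(j < p) zeta p ^+ (j ^ 3 * y) = cubic_gauss R p (zeta p) y%:R.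
Proof.
move=> p_pr; rewrite -(sum_Fp _ p (fun j => zeta p ^+ (j ^ 3 * y))) //.
apply: eq_bigr => x _; rewrite -(addchar_nat _ _ _ p_pr) ?eV_expq ?prime_gt0 //.
by rewrite natrM natrX natr_Zp mulrC.
Qed.

Lemma eV_prime_neq1 p : prime p -> zeta p != 1.
Proof.
move=> p_pr; have := eV_expn_eq1 R p 1 (prime_gt0 p_pr).
by rewrite expr1 dvdn1 => ->; rewrite gtn_eqF ?prime_gt1.
Qed.

Lemma cube_inj_Fp p : prime p -> (p = 2 %[mod 3] \/ p = 3)%N ->
  injective (fun x : 'F_p => x ^+ 3).
Proof.
move=> p_pr p23; have xp (x : 'F_p) : x ^+ p = x.
  by have := expf_card x; rewrite card_Fp.
case: p23 => [p2|p3]; last first.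
  by move=> x y /=; rewrite -p3 !xp.
have pE : p = (p %/ 3 * 3 + 2)%N by rewrite {1}(divn_eq p 3) p2.
(* With [p = 3 * k + 2] one has [3 * (2 * k + 1) = 2 * (p - 1) + 1], so this power inverts cubing by
   Fermat. *)
suff xE (x : 'F_p) : (x ^+ 3) ^+ (2 * (p %/ 3) + 1) = x.
  by move=> x y /= /(congr1 (fun z => z ^+ (2 * (p %/ 3) + 1))); rewrite !xE.
have [->|x0] := eqVneq x 0; first by rewrite addn1 !expr0n.
apply: (mulfI x0); rewrite -exprM -exprS.
rewrite (_ : (_.+1 = 2 * p)%N); last by rewrite [in RHS]pE; lia.
by rewrite mul2n -addnn exprD xp.
Qed.

Lemma cube_weight_all_cubes p : prime p -> (p = 2 %[mod 3] \/ p = 3)%N ->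
  cube_weight p (1 / p%:R).
Proof.
move=> p_pr p23; have p0 := prime_gt0 p_pr.
have pR : 0 < p%:R :> R by rewrite ltr0n.
exists (fun=> 1 / p%:R); split => //.
- move=> y; rewrite /cube_transform -mulr_sumr sum_zeta_cube // /cubic_gauss.
  (* Cubing permutes ['F_p], so the cubic Gauss sum is a complete character sum. *)
  have cinj := cube_inj_Fp p p_pr p23.
  under eq_bigr do rewrite mulrC.
  rewrite -(reindex_inj cinj (P := xpredT) (F := fun x => addchar R p (zeta p) (x * y%:R))) /=.
  rewrite sum_addchar_mul ?eV_expq ?eV_prime_neq1 //.
  by apply: mulr_ge0; [rewrite ler0c divr_ge0|case: ifP => _; rewrite ?ler0n].
- by rewrite sumr_const card_ord div1r -[LHS]mulr_natr mulVf ?gt_eqF.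
Qed.

(** Stated for every prime, so that the asymptotic bound can treat all prime factors of [q]
    alike. *)
Lemma cube_weight_gauss p : prime p -> cube_weight p (2 / Num.sqrt p%:R).
Proof.
move=> p_pr; have p0 := prime_gt0 p_pr.
have pR : 0 < p%:R :> R by rewrite ltr0n.
have s0 : 0 < Num.sqrt p%:R :> R by rewrite sqrtr_gt0.
set c := 2 / Num.sqrt p%:R.
have c0 : 0 < c by rewrite divr_gt0.
have c1 : 0 < 1 + c by lra.
have c2 : c ^+ 2 = 4 / p%:R by rewrite expr_div_n sqr_sqrtr ?ltW // -natrX.
(* The uniform weight plus an atom of mass [c] at 0, normalised to total mass 1. *)
pose w j : R := (p%:R^-1 + (j == 0%N)%:R * c) / (1 + c).
have pV0 : 0 < p%:R^-1 :> R by rewrite invr_gt0.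
have sumw (F : nat -> R[i]) : \sum_(j < p) (w j)%:C%C * F j
    = ((1 + c)^-1)%:C%C * ((p%:R^-1)%:C%C * (\sum_(j < p) F j) + c%:C%C * F 0%N).
  transitivity (((1 + c)^-1)%:C%C * \sum_(j < p)
      ((p%:R^-1)%:C%C * F j + if val j == 0%N then c%:C%C * F j else 0)).
    rewrite mulr_sumr; apply: eq_bigr => j _.
    rewrite /w mulrC rmorphM rmorphD /= [in LHS]mulrC mulrAC [in LHS]mulrC.
    congr (_ * _); rewrite mulrDl; congr (_ + _).
    by case: eqP => _; rewrite ?mul1r // mul0r rmorph0 mul0r.
  congr (_ * _); rewrite big_split /= -mulr_sumr; congr (_ + _).
  by rewrite -big_mkcond (big_pred1 (Ordinal p0)).
exists w; split.
- move=> y; rewrite /cube_transform (sumw (fun j => zeta p ^+ (j ^ 3 * y))).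
  rewrite mul0n expr0 mulr1 sum_zeta_cube // cubic_gauss_real ?eV_expq ?conjc_e //.
  set t := complex.Re _; rewrite -rmorphM -rmorphD -rmorphM /= ler0c.
  apply: mulr_ge0; first by rewrite invr_ge0 ltW.
  have [y0|y0] := eqVneq (y%:R : 'F_p) 0.
    have -> : t = p%:R.
      by rewrite /t y0 cubic_gauss0 ?eV_expq // -(rmorph_nat (real_complex R)).
    by rewrite mulVf ?gt_eqF // ltW.
  have t2 : t ^+ 2 <= 4 * p%:R.
    by apply: cubic_gauss_bound => //; rewrite ?eV_expq ?conjc_e ?eV_prime_neq1.
  (* The value of [c] is chosen for this: [4 * p / p ^ 2 = c ^+ 2], so the atom outweighs any
     negative value of [t / p]. *)
  have : (p%:R^-1 * t) ^+ 2 <= c ^+ 2.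
    rewrite c2 exprMn mulrC exprVn ler_pdivrMr ?exprn_gt0 //.
    by rewrite expr2 mulrA divfK ?gt_eqF.
  move: (p%:R^-1 * t) => u uc; rewrite leNgt; apply/negP => uc0.
  by move: uc c0 uc0; nra.
- have := sumw (fun=> 1); under eq_bigr do rewrite mulr1.
  rewrite -rmorph_sum mulr1 sumr_const card_ord -(rmorph_nat (real_complex R)).
  rewrite -rmorphM -rmorphD -rmorphM /= => -[->].
  by rewrite mulVf ?gt_eqF // mulVf ?gt_eqF.
- by rewrite /w eqxx mul1r divr_ge0 ?ltW // addr_gt0.
(* After clearing [1 + c] this is [1 / p <= c ^+ 2 = 4 / p]. *)
- rewrite /w eqxx mul1r ler_pdivrMr // mulrDr mulr1 -expr2 c2; lra.
Qed.
End Weights.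

(** The square of [gcdn m n] divides [m * n]. *)
Lemma squarefreeM_coprime m n : squarefree (m * n) -> coprime m n.
Proof.
case=> mn0 sq; rewrite /coprime eqn_leq; apply/andP; split; last first.
  by move: mn0; rewrite muln_gt0 gcdn_gt0 => /andP[->].
rewrite leqNgt; apply/negP => /sq /negP; apply.
by rewrite expnS expn1 dvdn_mul ?dvdn_gcdl ?dvdn_gcdr.
Qed.

(** * Bounds for [lambda_C0] *)

Section Lambda.
Variable R : realType.
Implicit Types (q : nat) (b : nat -> R) (c : R).

Lemma cube_weight_prod (I : eqType) (s : seq I) (f : I -> nat) (c : I -> R) :
  squarefree (\prod_(i <- s) f i) ->
  (forall i, i \in s -> cube_weight R (f i) (c i)) ->
  cube_weight R (\prod_(i <- s) f i) (\prod_(i <- s) c i).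
Proof.
elim: s => [|i s IH]; first by rewrite !big_nil => _ _; apply: cube_weight1.
rewrite !big_cons => sq cw.
have : (0 < f i * \prod_(j <- s) f j)%N := proj1 sq.
rewrite muln_gt0 => /andP[fi0 fs0].
apply: cube_weight_coprime => //; first exact: squarefreeM_coprime.
- by apply: cw; rewrite inE eqxx.
- apply: IH; first by apply: squarefree_dvd sq _; rewrite dvdn_mull.
  by move=> j js; apply: cw; rewrite inE js orbT.
Qed.

Lemma witness_ge0 q b : (0 < q)%N -> cubic_modular_witness q b -> 0 <= b 0%N.
Proof.
move=> q0 [b_ge0 _].
pose g y := b 0%N + \sum_(1 <= j < q | ~~ (q %| j ^ 3)%N)
  2 * b j * complex.Re (e (q%:R^-1 : R) ^+ (j ^ 3 * y)).
have : 0 <= \sum_(y < q) g y.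
  by apply: sumr_ge0 => y _; rewrite -ler0c -cubic_fun_nat b_ge0.
rewrite big_split /= sumr_const card_ord exchange_big /= big1 => [|j qj].
  by rewrite addr0 pmulrn_lge0.
rewrite -mulr_sumr -Re_sum.
(* The sum over [y] is geometric, with a ratio that is a [q]-th root of unity and differs from 1
   because [q] does not divide [j ^ 3]; so it vanishes. *)
have : (e (q%:R^-1 : R) ^+ (j ^ 3)) ^+ q - 1 = 0.
  by rewrite exprAC eV_expq // expr1n subrr.
rewrite subrX1 => /eqP; rewrite mulf_eq0 subr_eq0 eV_expn_eq1 // (negPf qj) /=.
move=> /eqP S0; under eq_bigr do rewrite exprM.
by rewrite S0 mulr0.
Qed.

Lemma lambda_C0_ge0 q : (0 < q)%N -> 0 <= lambda_C0 R q.
Proof.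
move=> q0; rewrite /lambda_C0; set E := [set _ | _ in _].
(* The infimum of the empty set is 0 by convention. *)
have [->|E0] := eqVneq E set0; first by rewrite inf0.
by apply: lb_le_inf; [exact/set0P|move=> _ [b wb <-]; apply: witness_ge0 wb].
Qed.

Lemma lambda_C0_le q c : squarefree q -> cube_weight R q c -> lambda_C0 R q <= c.
Proof.
move=> sq /(cube_weight_witness _ _ _ sq)[b [wb bc]]; apply: le_trans bc.
apply: ge_inf; last by exists b.
(* An element bounds the real infimum from above once the set is bounded below, here by 0. *)
by exists 0 => _ [d wd <-]; apply: witness_ge0 wd; case: sq.
Qed.

Lemma sqrtr_prod (I : Type) (s : seq I) (F : I -> R) : (forall i, 0 <= F i) ->
  Num.sqrt (\prod_(i <- s) F i) = \prod_(i <- s) Num.sqrt (F i).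
Proof.
move=> F0; elim: s => [|i s IH]; first by rewrite !big_nil sqrtr1.
by rewrite !big_cons sqrtrM // IH.
Qed.

Lemma powR_prod (I : Type) (s : seq I) (F : I -> R) (x : R) :
  (forall i, 0 <= F i) ->
  (\prod_(i <- s) F i) `^ x = \prod_(i <- s) (F i) `^ x.
Proof.
move=> F0; elim: s => [|i s IH]; first by rewrite !big_nil powR1.
by rewrite !big_cons powRM ?prodr_ge0 // IH.
Qed.

Lemma prod_small_le (s : seq nat) (N : nat) : uniq s ->
  \prod_(p <- s) (if (p < N)%N then 2 else 1) <= 2 ^+ N :> R.
Proof.
move=> us; rewrite -big_mkcond -big_filter big_const_seq count_predT iter_mulr_1.
rewrite ler_weXn2l ?ler1n // -[leqRHS](size_iota 0); apply: uniq_leq_size.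
  exact: filter_uniq.
by move=> p; rewrite mem_filter mem_iota => /andP[].
Qed.

(** Once [p] exceeds [2]^ eps^-1[, the numerator 2 is absorbed by]p [^ eps]; for smaller [p] it is
    kept as an explicit factor. *)
Lemma two_div_sqrt_le (eps : R) (p : nat) : 0 < eps -> (0 < p)%N ->
  2 / Num.sqrt p%:R
  <= (if (p < Num.bound (2 `^ eps^-1))%N then 2 else 1)
     * p%:R `^ (- (1 / 2) + eps).
Proof.
move=> eps0 p0; have pR : 0 < p%:R :> R by rewrite ltr0n.
rewrite powRD ?(gt_eqF pR) ?implybT // powRN div1r powR12_sqrt //.
rewrite [leLHS]mulrC [leRHS]mulrCA ler_wpM2l ?invr_ge0 ?sqrtr_ge0 //.
case: ltnP => pN.
  by apply: ler_peMr => //; rewrite -[leLHS](powRr0 p%:R) ler_powR ?ler1n ?ltW.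
have two : (2 `^ eps^-1) `^ eps = 2 :> R.
  by rewrite -powRrM mulVf ?gt_eqF // powRr1.
rewrite mul1r -[leLHS]two.
apply: ge0_ler_powR; rewrite ?nnegrE ?powR_ge0 //; first exact: ltW.
by apply: le_trans (ltW (archi_boundP (powR_ge0 _ _))) _; rewrite ler_nat.
Qed.

Lemma lambda_C0_bigO (eps : R) : 0 < eps ->
  exists K : R, 0 < K /\ forall q, squarefree q ->
    `|lambda_C0 R q| <= K * q%:R `^ (- (1 / 2) + eps).
Proof.
(* The constant collects one factor 2 for each possible prime below the threshold of
   [two_div_sqrt_le]. *)
move=> eps0; exists (2 ^+ Num.bound (2 `^ eps^-1)); split; first exact: exprn_gt0.
move=> q sq; have q0 := proj1 sq; rewrite ger0_norm ?lambda_C0_ge0 //.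
have pp p : p \in primes q -> prime p by rewrite mem_primes => /and3P[].
have cw : cube_weight R q (\prod_(p <- primes q) (2 / Num.sqrt p%:R)).
  rewrite -[in X in cube_weight R X](squarefree_prod_primes _ sq).
  apply: cube_weight_prod; first by rewrite squarefree_prod_primes.
  by move=> p /pp; apply: cube_weight_gauss.
apply: le_trans (lambda_C0_le _ _ sq cw) _.
rewrite -[in X in _ * X `^ _](squarefree_prod_primes _ sq) natr_prod powR_prod //.
apply: le_trans (ler_wpM2r _ (prod_small_le _ _ (primes_uniq q))); last first.
  by apply: prodr_ge0 => p _; apply: powR_ge0.
rewrite -big_split /= big_seq [leRHS]big_seq; apply: ler_prod => p /pp p_pr.
by rewrite divr_ge0 ?sqrtr_ge0 //= two_div_sqrt_le ?prime_gt0.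
Qed.

End Lambda.

Theorem theorem2p1 (R : realType) :
  (forall (q r m : nat) (p : 'I_r -> nat) (s : 'I_m -> nat),
      squarefree q ->
      q = ((\prod_(i < r) p i) * (\prod_(l < m) s l))%N ->
      (forall i, prime (p i) /\ (p i = 2 %[mod 3] \/ p i = 3)%N) ->
      (forall l, prime (s l) /\ (s l = 1 %[mod 3])%N) ->
      (exists b : nat -> R,
          [/\ cubic_modular_witness q b,
              b 0%N <= (\prod_(i < r) (1 / (p i)%:R))
                       * (\prod_(l < m) (2 / Num.sqrt (s l)%:R))
            & (\prod_(i < r) (1 / (p i)%:R))
              * (\prod_(l < m) (2 / Num.sqrt (s l)%:R))
                <= 2 ^+ m / Num.sqrt q%:R :> R])
      /\ lambda_C0 R q <= 2 ^+ m / Num.sqrt q%:R)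
  /\ (forall eps : R, 0 < eps ->
        exists K : R, 0 < K /\
          forall q : nat, squarefree q ->
            `|lambda_C0 R q| <= K * q%:R `^ (- (1 / 2) + eps)).
Proof.
split; last exact: lambda_C0_bigO.
move=> q r m p s sq qE p_pr s_pr.
have p0 i : 0 < (p i)%:R :> R by rewrite ltr0n prime_gt0 //; case: (p_pr i).
have cw : cube_weight R q ((\prod_(i < r) (1 / (p i)%:R))
                           * (\prod_(l < m) (2 / Num.sqrt (s l)%:R))).
  have [q0 cps] := (proj1 sq, sq); rewrite qE in q0 cps *.
  move: (q0); rewrite muln_gt0 => /andP[A0 B0].
  apply: cube_weight_coprime => //; first exact: squarefreeM_coprime.
    apply: cube_weight_prod; first by apply: squarefree_dvd cps _; rewrite dvdn_mulr.
    by move=> i _; case: (p_pr i) => *; apply: cube_weight_all_cubes.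
  apply: cube_weight_prod; first by apply: squarefree_dvd cps _; rewrite dvdn_mull.
  by move=> l _; case: (s_pr l) => *; apply: cube_weight_gauss.
have bound : (\prod_(i < r) (1 / (p i)%:R)) * (\prod_(l < m) (2 / Num.sqrt (s l)%:R))
    <= 2 ^+ m / Num.sqrt q%:R :> R.
  rewrite qE natrM sqrtrM // !natr_prod !sqrtr_prod // [X in _ * X <= _]big_split /=.
  rewrite prodr_const card_ord prodfV invfM [leLHS]mulrCA ler_wpM2l ?exprn_ge0 //.
  (* The factors from the [s l] agree on both sides; what remains is [1 / p i <= 1 / sqrt (p i)], as
     [p i] is at least 1. *)
  rewrite ler_wpM2r ?invr_ge0 ?prodr_ge0 // -prodfV; apply: ler_prod => i _.
  rewrite div1r invr_ge0 (ltW (p0 i)) /= lef_pV2 ?posrE ?sqrtr_gt0 //.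
  rewrite -[leRHS]sqr_sqrtr ?(ltW (p0 i)) // expr2 ler_peMr ?sqrtr_ge0 //.
  by rewrite -[leLHS]sqrtr1 ler_wsqrtr // ler1n -(ltr0n R).
split; last exact: le_trans (lambda_C0_le _ _ _ sq cw) bound.
by have [b [wb bc]] := cube_weight_witness _ _ _ sq cw; exists b.
Qed.
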